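(* Let $(S_t)_{t\ge 0}$ be an $\alpha$-stable subordinator with index $\alpha\in(0,1)$. Then the following hold. (1) If $\theta\in[\frac1\alpha,\infty)$, then almost surely $$\int_0^T t^{-\theta}\,dS_t=\infty\quad\text{for all } T>0.$$ (2) If $\theta\in(0,\frac1\alpha)$, then almost surely $$\int_0^T t^{-\theta}\,dS_t<\infty\quad\text{for all } T>0.$$ (3) If $\theta\in(0,\frac1\alpha)$, then for every $p\in(0,\alpha)$ and every $T>0$, $$\mathbb{E}\left[\left(\int_0^T t^{-\theta}\,dS_t\right)^{p}\right]\le\left(\frac{2^{\frac p\alpha+p\theta}\,\mathbb{E}[S_1^{p}]}{2^{\frac p\alpha}-2^{p\theta}}+1\right)T^{(\frac1\alpha-\theta)p}.$$ (4) For every $\lambda>0$, every $p\in(0,\alpha)$ and every $T>0$, $$\mathbb{E}\left[\left(\int_0^T e^{-\lambda(T-t)}\,dS_t\right)^{p}\right]\le\frac{e^{p\lambda}}{e^{p\lambda}-1}\,\mathbb{E}[S_1^{p}].$$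
   Context: For $\alpha\in(0,1)$, an $\alpha$-stable subordinator $(S_t)_{t\ge0}$ is a non-negative real-valued increasing Lévy process (so $S_0=0$, with stationary independent increments and càdlàg paths) with Laplace transform $\mathbb{E}[e^{-\lambda S_t}]=\exp(-\lambda^{\alpha}t)$ for all $\lambda>0$ and $t\ge0$. For a non-negative continuous function $f$ on $(0,T]$, the integral $\int_0^T f(t)\,dS_t$ is the pathwise Lebesgue–Stieltjes integral over $(0,T]$ with respect to the increasing càdlàg path $t\mapsto S_t$; it takes values in $[0,\infty]$ and equals $\lim_{\varepsilon\downarrow0}\int_{(\varepsilon,T]}f(t)\,dS_t$. *)

(* Defs.v *)
From HB Require Import structures.
From mathcomp Require Import all_boot all_order all_algebra.
From mathcomp Require Import all_classical all_reals all_analysis.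
From mathcomp Require Import measurable_realfun.

Set Implicit Arguments.
Unset Strict Implicit.
Unset Printing Implicit Defensive.

Import Order.TTheory GRing.Theory Num.Theory.
Import numFieldNormedType.Exports.

Local Open Scope classical_set_scope.
Local Open Scope ring_scope.

Section paths.
Context {R : realType}.
Implicit Types F : R -> R.

(* Paths are indexed by [0, +oo[; their values at negative times are ignored. *)
Definition cadlag F :=
  (forall t, 0 <= t -> F s @[s --> t^'+] --> F t) /\
  (forall t, 0 < t -> cvg (F s @[s --> t^'-])).

Definition increasing_path F :=
  forall s t, 0 <= s -> s <= t -> F s <= F t.

(* The Lebesgue-Stieltjes measure lives on the whole line, so the path is
   extended by the constant F 0 to negative times; only its restriction to
   ]0, +oo[ is used below. *)
Definition extend_path F : R -> R := fun t => F (Num.max t 0).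

Definition is_cumulative F := nondecreasing F /\ right_continuous F.

Definition cumulative_of F (H : is_cumulative F) : cumulative R R :=
  HB.pack F (isCumulative.Build R _ _ F H.1 H.2).

(* The zero measure is a dummy value for paths that are not nondecreasing and
   right-continuous on [0, +oo[. *)
Definition path_measure F : {measure set measurableTypeR R -> \bar R} :=
  match pselect (is_cumulative (extend_path F)) with
  | left H => lebesgue_stieltjes_measure (cumulative_of H)
  | right _ => mzero
  end.

Definition path_integral F (f : R -> R) (T : R) : \bar R :=
  (\int[path_measure F]_(t in `]0%R, T]) (f t)%:E)%E.

End paths.

Section processes.
Context {d : measure_display} {Omega : measurableType d} {R : realType}
  (P : probability Omega R).

Definition same_law (X Y : {RV P >-> R}) :=
  forall A : set R, measurable A -> distribution P X A = distribution P Y A.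

Definition independent_RVs (I : finType) (X : I -> {RV P >-> R}) :=
  forall B : I -> set R, (forall i, measurable (B i)) ->
    P (\bigcap_(i in setT) (X i @^-1` B i)) =
    (\big[*%E/1%E]_(i : I) P (X i @^-1` B i))%E.

Implicit Types S : R -> {RV P >-> R}.

Definition increment S (s t : R) : {RV P >-> R} :=
  ((S t : {mfun Omega >-> R}) - S s)%R.

Definition independent_increments S :=
  forall (n : nat) (t : nat -> R), 0 <= t 0%N ->
    {homo t : i j / (i <= j)%N >-> i <= j} ->
    independent_RVs (fun i : 'I_n => increment S (t i) (t i.+1)).

Definition stationary_increments S :=
  forall s h : R, 0 <= s -> 0 <= h -> same_law (increment S s (s + h)) (S h).

(* The process is (S t) for t >= 0; S t is ignored for t < 0. *)
Record levy_process S : Prop := {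
  levy_start : {ae P, forall w, S 0 w = 0} ;
  levy_independent : independent_increments S ;
  levy_stationary : stationary_increments S ;
  levy_cadlag : {ae P, forall w, cadlag (fun t => S t w)}
}.

Record stable_subordinator (alpha : R) S : Prop := {
  subordinator_levy : levy_process S ;
  subordinator_ge0 : {ae P, forall w, forall t : R, 0 <= t -> 0 <= S t w} ;
  subordinator_increasing : {ae P, forall w, increasing_path (fun t => S t w)} ;
  subordinator_laplace : forall lambda t : R, 0 < lambda -> 0 <= t ->
    'E_P[fun w => expR (- lambda * S t w)]%E =
    (expR (- (lambda `^ alpha) * t))%:E
}.

(* int_0^T f(t) dS_t at the outcome w *)
Definition integral_dS S (f : R -> R) (T : R) (w : Omega) : \bar R :=
  path_integral (fun t => S t w) f T.

End processes.

(* Main.v *)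
Require Import Defs.
From HB Require Import structures.
From mathcomp Require Import all_boot all_order all_algebra.
From mathcomp Require Import all_classical all_reals all_analysis.
From mathcomp Require Import measurable_realfun.
From mathcomp Require Import ring lra.

(** The interval ]0, T] is cut along a decreasing sequence u_n tending to 0, so
    that the pathwise integral of f is comparable to the series
    sum_n c_n (S_{u_n} - S_{u_(n+1)}) with c_n close to f on ]u_(n+1), u_n].

    - Divergence: for u_n = 2^-n and theta >= 1/alpha, each of the independent
      terms exceeds 1/4 with probability bounded below (Markov's inequality for
      the Laplace transform), hence infinitely many of them do.
    - Finiteness: E sum_n (1 - exp (- c_n S_{u_n})) is a convergent geometric
      series by the Laplace transform formula, and finiteness of
      sum_n (1 - exp (- x_n)) entails that of sum_n x_n.
    - Moments: x |-> x^p is subadditive and the increments are stationary. For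
      (4), u_n = max (T - n, 0). For (3), u_n = T / 2^n, and one needs
      E [S_t^p] <= 2^(p/alpha) t^(p/alpha) E [S_1^p]. Laplace transforms being
      the only information on the law, x^p is compared with
      phi (x) = sum_{k in Z} rho^(- k p) (1 - exp (- rho^k x)),
      rho = 2^(1/alpha), which satisfies phi (rho x) = rho^p phi (x); the loss
      rho^p in the comparison is exactly the slack in the constant of (3). *)

Import Order.TTheory GRing.Theory Num.Theory.
Import numFieldNormedType.Exports.

Local Open Scope classical_set_scope.
Local Open Scope ring_scope.

(** * Stieltjes measure of half-open intervals for a regular path *)

Lemma is_cumulative_extend_path {R : realType} {F : R -> R} :
  cadlag F -> increasing_path F -> is_cumulative (extend_path F).
Proof.
move=> [Fr _] Fi; split=> [s t st|x].
  by apply: Fi; rewrite ?ge_max !le_max ?lexx ?orbT ?st.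
rewrite /extend_path; have [x0|x0] := leP 0 x.
- apply: cvg_trans (Fr x x0); apply: near_eq_cvg.
  have : \forall t \near x^'+, x <= t by exact: nbhs_right_ge.
  by apply: filterS => t xt; rewrite !max_l// (le_trans x0).
- apply: (@cvg_trans _ (F 0 @[_ --> x^'+])); last exact: cvg_cst.
  apply: near_eq_cvg.
  have : \forall t \near x^'+, t <= 0 by exact: nbhs_right_le.
  by apply: filterS => t t0; rewrite !max_r.
Qed.

Lemma lebesgue_stieltjes_itvoc {R : realType} (G : cumulative R R) (a b : R) :
  a <= b -> lebesgue_stieltjes_measure G `]a, b]%classic = (G b - G a)%:E.
Proof.
move=> ab; rewrite /lebesgue_stieltjes_measure /measure_extension/=.
by rewrite measurable_mu_extE/= ?wlength_itv_bnd//; exact: is_ocitv.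
Qed.

(** Regularity of the path excludes the dummy zero measure, and clipping at time 0 has no effect
    because [0 <= a]. *)
Lemma path_measure_itvoc {R : realType} {F : R -> R} (a b : R) :
  cadlag F -> increasing_path F -> 0 <= a -> a <= b ->
  path_measure F (`]a, b]%classic) = (F b - F a)%:E.
Proof.
move=> Fc Fi a0 ab; rewrite /path_measure.
case: pselect => [H|]; last by case; exact: is_cumulative_extend_path.
have -> : (F b - F a) = (cumulative_of H b - cumulative_of H a).
  by rewrite /= /extend_path !max_l// (le_trans a0).
exact: lebesgue_stieltjes_itvoc.
Qed.

(** * Comparison of the pathwise integral with series of increments *)

Section pathwise.
Context {R : realType} (F : R -> R) (f : R -> R).
Hypotheses (Fc : cadlag F) (Fi : increasing_path F).
Hypotheses (mf : measurable_fun setT f) (f0 : forall x, 0 <= f x).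

Let memf (D : set (measurableTypeR R)) :
  measurable_fun D (EFin \o f : measurableTypeR R -> \bar R).
Proof. by apply: measurable_funTS; exact/measurable_EFinP. Qed.

Lemma path_integral_ge0 T : (0 <= path_integral F f T)%E.
Proof. by apply: integral_ge0 => x _; rewrite lee_fin f0. Qed.

Lemma le_path_integral S T : S <= T ->
  (path_integral F f S <= path_integral F f T)%E.
Proof.
move=> ST; apply: ge0_subset_integral => //; try exact: measurable_itv.
- by move=> x _; rewrite lee_fin f0.
- by apply: subset_itvl; rewrite bnd_simp.
Qed.

Variable u : nat -> R.
Hypotheses (u0 : forall n, 0 <= u n) (du : forall n, u n.+1 <= u n)
  (u_lt : forall t, 0 < t -> exists n, u n < t).

(** Since [u] falls below every positive number, the pieces cover everything down to 0, and 0 itself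
    is excluded. The sequence may become constant, in which case the remaining pieces are empty. *)
Lemma path_integral_partition :
  path_integral F f (u 0%N) =
  (\sum_(n <oo) \int[path_measure F]_(t in `](u n.+1), (u n)]) (f t)%:E)%E.
Proof.
rewrite -ge0_integral_bigcup//.
- congr (integral _ _ _); apply/seteqP; split=> x /=; rewrite in_itv/=.
  (* The least index with [u] below [x] is not 0, as [x <= u 0]; its predecessor labels the piece
     containing [x]. *)
  + move=> /andP[/u_lt/ex_minnP[[|m] um mm] xu].
      by move: xu; rewrite leNgt um.
    exists m => //=; rewrite in_itv/= um/= leNgt; apply/negP => /mm.
    by rewrite ltnn.
  + move=> [n _ /=]; rewrite in_itv/= => /andP[ux xu].
    rewrite (le_lt_trans (u0 n.+1) ux)/= (le_trans xu)//.
    by elim: n {ux xu} => // n; apply: le_trans.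
- by move=> x _; rewrite lee_fin f0.
- have du' m n : (m <= n)%N -> u n <= u m.
    by move=> /subnK <-; elim: (n - m)%N => // k; apply: le_trans; exact: du.
  apply: ltn_trivIset => m n mn; apply/seteqP; split=> x //= [].
  rewrite !in_itv/= => /andP[a1 a2] /andP[b1 b2].
  by have := lt_le_trans a1 b2; rewrite ltNge du'.
Qed.

Lemma path_integral_le (c : nat -> R) : (forall n, 0 <= c n) ->
  (forall n t, u n.+1 < t -> t <= u n -> f t <= c n) ->
  (path_integral F f (u 0%N) <=
     \sum_(n <oo) (c n * (F (u n) - F (u n.+1)))%:E)%E.
Proof.
move=> c0 fc; rewrite path_integral_partition; apply: lee_nneseries.
  by move=> n _ _; apply: integral_ge0 => x _; rewrite lee_fin f0.
move=> n _; rewrite EFinM -path_measure_itvoc// -integral_cst//.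
apply: ge0_le_integral => //.
- by move=> x _; rewrite lee_fin f0.
- by move=> x /=; rewrite in_itv/= => /andP[? ?]; rewrite lee_fin fc.
Qed.

Lemma path_integral_ge (c : nat -> R) : (forall n, 0 <= c n) ->
  (forall n t, u n.+1 < t -> t <= u n -> c n <= f t) ->
  (\sum_(n <oo) (c n * (F (u n) - F (u n.+1)))%:E <=
     path_integral F f (u 0%N))%E.
Proof.
move=> c0 fc; rewrite path_integral_partition; apply: lee_nneseries.
  by move=> n _ _; rewrite lee_fin mulr_ge0 ?subr_ge0 ?Fi.
move=> n _; rewrite EFinM -path_measure_itvoc// -integral_cst//.
apply: ge0_le_integral => //.
- by move=> x _; rewrite lee_fin.
- by move=> x /=; rewrite in_itv/= => /andP[? ?]; rewrite lee_fin fc.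
Qed.

End pathwise.

(** * Subadditivity of the power function for exponents in ]0, 1] *)

Section subadditivity.
Context {R : realType} (p : R).
Hypotheses (p0 : 0 < p) (p1 : p <= 1).

(** The fractions a / (a + b) and b / (a + b) lie in [0, 1], where x is at most x^p, and they add up
    to 1; multiplying by (a + b)^p gives the claim. *)
Lemma powR_subadditive (a b : R) : 0 <= a -> 0 <= b ->
  (a + b) `^ p <= a `^ p + b `^ p.
Proof.
move=> a0 b0; have := addr_ge0 a0 b0; rewrite le_eqVlt => /predU1P[<-|s0].
  by rewrite powR0 ?gt_eqF// addr_ge0 ?powR_ge0.
have le_pow x : 0 <= x -> x <= 1 -> x <= x `^ p.
  rewrite le_eqVlt => /predU1P[<- _|x0 x1]; first exact: powR_ge0.
  by apply: ger1_powR; rewrite ?x0.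
have s0' := ltW s0.
have le_frac x : 0 <= x -> x <= a + b -> x * (a + b) `^ p <= x `^ p * (a + b).
  move=> x0 xs; rewrite -{2}(divfK (lt0r_neq0 s0) x) powRM ?divr_ge0//.
  rewrite mulrAC ler_wpM2r ?powR_ge0// -ler_pdivrMr//.
  by apply: le_pow; rewrite ?divr_ge0// ler_pdivrMr// mul1r.
rewrite -(ler_pM2r s0) [leLHS]mulrC !mulrDl.
by apply: lerD; apply: le_frac; rewrite // ?lerDl ?lerDr.
Qed.

Lemma powR_sum_le (x : nat -> R) n : (forall i, 0 <= x i) ->
  (\sum_(0 <= i < n) x i) `^ p <= \sum_(0 <= i < n) x i `^ p.
Proof.
move=> x0; elim: n => [|n ih]; first by rewrite !big_nil powR0 ?gt_eqF.
rewrite !big_nat_recr//=; apply: (le_trans (powR_subadditive _ _ _ _)) => //.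
  exact: sumr_ge0.
by rewrite lerD2r.
Qed.

(** Writing [M] as (M^(1/p))^p reduces the claim to bounding each partial sum by M^(1/p), which is
    the finite case; this replaces a passage to the limit inside the power. *)
Lemma poweR_nneseries_le (x : nat -> R) : (forall i, 0 <= x i) ->
  ((\sum_(n <oo) (x n)%:E) `^ p <= \sum_(n <oo) (x n `^ p)%:E)%E.
Proof.
move=> x0; set M := (leRHS).
have M0 : (0 <= M)%E by apply: nneseries_ge0 => n _ _; rewrite lee_fin powR_ge0.
have pV : p^-1 * p = 1 by rewrite mulVf ?gt_eqF.
rewrite -[M]poweRe1// -pV poweRrM; apply: gt0_ler_poweR; first exact: ltW.
- rewrite in_itv/= leey andbT; apply: nneseries_ge0 => n _ _.
  by rewrite lee_fin.
- by rewrite in_itv/= leey andbT poweR_ge0.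
apply: lime_le; first by apply: is_cvg_nneseries => n _ _; rewrite lee_fin.
apply: nearW => n; rewrite sumEFin.
have s0 : 0 <= \sum_(0 <= i < n) x i by exact: sumr_ge0.
rewrite -[_%:E]poweRe1 ?lee_fin// -pV mulrC poweRrM; apply: gt0_ler_poweR.
- by rewrite invr_ge0 ltW.
- by rewrite in_itv/= leey andbT lee_fin powR_ge0.
- by rewrite in_itv/= leey andbT.
rewrite poweR_EFin; apply: (@le_trans _ _ (\sum_(0 <= i < n) x i `^ p)%:E).
  by rewrite lee_fin powR_sum_le.
by rewrite -sumEFin; apply: nneseries_lim_ge => k _ _; rewrite lee_fin powR_ge0.
Qed.

End subadditivity.

(** * Almost sure comparison of integrals, geometric series and growth of powers *)

(* [f] is not assumed measurable: its integral is the supremum of the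
   integrals of the simple functions below it. *)
Lemma ae_le_integral_measurable_bound {d} {T : measurableType d} {R : realType}
    (mu : {measure set T -> \bar R}) (f g : T -> \bar R) :
  (forall x, 0 <= f x)%E -> (forall x, 0 <= g x)%E -> measurable_fun setT g ->
  {ae mu, forall x, (f x <= g x)%E} -> (\int[mu]_x f x <= \int[mu]_x g x)%E.
Proof.
move=> f0 g0 mg [N [mN N0 fgN]].
pose h x := if x \in N then +oo%E else g x.
have h0 x : (0 <= h x)%E by rewrite /h; case: ifP.
have mh : measurable_fun setT h.
  apply: measurable_fun_ifT => //; apply: (measurable_fun_bool true).
  rewrite setTI (_ : _ @^-1` _ = N)//.
  by apply/seteqP; split => x /= => [/set_mem|/mem_set].
have -> : (\int[mu]_x g x = \int[mu]_x h x)%E.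
  apply: ge0_ae_eq_integral => //; exists N; split => // x /=.
  rewrite /h; case: ifPn => [/set_mem//|_]; by move/not_implyP => [].
rewrite !ge0_integralTE//; apply: ereal_sup_le => _ [k kf <-].
exists k => // x; apply: (le_trans (kf x)); rewrite /h.
case: ifPn => [_|/negP xN]; first exact: leey.
apply: contrapT => fg; apply: xN; rewrite inE.
exact: fgN.
Qed.

Lemma nneseries_geometric {R : realType} (z : R) : 0 <= z -> z < 1 ->
  (\sum_(n <oo) (z ^+ n)%:E = ((1 - z)^-1)%:E)%E.
Proof.
move=> z0 z1; apply/cvg_lim => //.
rewrite (_ : (fun _ => _) = EFin \o series (geometric 1 z)); last first.
  apply/funext => n /=; rewrite sumEFin; congr EFin.
  by apply: eq_bigr => i _; rewrite /= mul1r.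
apply: cvg_EFin; first exact: nearW.
have := @cvg_geometric_series R 1 z; rewrite mul1r; apply.
by rewrite ger0_norm.
Qed.

Lemma exists_ltr_exprn {R : realType} (rho x : R) :
  1 < rho -> exists n, x < rho ^+ n.
Proof.
move=> r1; have := @cvg_geometric R x rho^-1.
rewrite normfV gtr0_norm ?(lt_trans ltr01)// invf_lt1 ?(lt_trans ltr01)// => /(_ r1).
move=> /cvgr_lt /(_ _ ltr01)[n _ /(_ n (leqnn n))] /=.
rewrite exprVn ltr_pdivrMr ?mul1r; first by exists n.
by rewrite exprn_gt0// (lt_trans ltr01).
Qed.

(** * The self-similar substitute for x^p built from Laplace kernels *)

Section self_similar_series.
Context {R : realType} (p rho : R).
Hypotheses (p0 : 0 < p) (p1 : p < 1) (rho1 : 1 < rho).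

(** Up to a constant, x^p is the integral of this function of s against ds / s over s > 0 when 0 < p
    < 1. Sampling s at the powers of [rho] gives [laplace_series]. *)
Definition laplace_term (s x : R) := s `^ (- p) * (1 - expR (- (s * x))).

Lemma laplace_term_ge0 s x : 0 <= s -> 0 <= x -> 0 <= laplace_term s x.
Proof.
by move=> s0 x0; rewrite mulr_ge0 ?powR_ge0// subr_ge0 expR_le1 oppr_le0 mulr_ge0.
Qed.

Lemma le_laplace_term s x y : 0 <= s -> x <= y ->
  laplace_term s x <= laplace_term s y.
Proof.
move=> s0 xy; rewrite ler_wpM2l ?powR_ge0// lerD2l lerN2 ler_expR lerN2.
by rewrite ler_wpM2l.
Qed.

Lemma laplace_termM s c x : 0 < s -> 0 < c ->
  laplace_term s (c * x) = c `^ p * laplace_term (c * s) x.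
Proof.
move=> s0 c0; rewrite /laplace_term (powRM _ (ltW c0) (ltW s0)) !mulrA.
rewrite -powRD ?(lt0r_neq0 c0) ?implybT//.
by rewrite subrr powRr0 mul1r [s * c]mulrC.
Qed.

Let rho0 : 0 < rho. Proof. exact: lt_trans rho1. Qed.
Let rhon0 n : 0 < rho ^+ n. Proof. exact: exprn_gt0. Qed.
Let rhoV0 n : 0 < rho ^- n. Proof. by rewrite invr_gt0. Qed.

(* The two-sided sum over all integer powers of [rho] makes the series
   homogeneous of degree [p] under the scaling by [rho]. *)
Definition laplace_series (x : R) : \bar R :=
  (\sum_(k <oo) (laplace_term (rho ^+ k) x)%:E +
   \sum_(k <oo) (laplace_term (rho ^- k.+1) x)%:E)%E.

Lemma laplace_series_ge0 x : 0 <= x -> (0 <= laplace_series x)%E.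
Proof.
move=> x0; apply: adde_ge0; apply: nneseries_ge0 => n _ _;
  by rewrite lee_fin laplace_term_ge0// ltW.
Qed.

Lemma le_laplace_series x y : 0 <= x -> x <= y ->
  (laplace_series x <= laplace_series y)%E.
Proof.
move=> x0 xy; apply: leeD; apply: lee_nneseries => n _ *;
  by rewrite lee_fin (laplace_term_ge0, le_laplace_term)// ltW.
Qed.

Lemma laplace_series0 : laplace_series 0 = 0%E.
Proof.
rewrite /laplace_series !eseries0 ?adde0// => k _ _;
  by rewrite /laplace_term mulr0 oppr0 expR0 subrr mulr0.
Qed.

(** Scaling [x] by [rho] shifts the exponent of [rho] by one in both halves; the term of exponent 0
    leaves the first half and enters the second. *)
Lemma laplace_series_rho x : 0 <= x ->
  laplace_series (rho * x) = ((rho `^ p)%:E * laplace_series x)%E.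
Proof.
move=> x0; rewrite /laplace_series.
under eq_eseriesr do rewrite laplace_termM// -exprS EFinM.
under [X in (_ + X)%E]eq_eseriesr.
  move=> k _; rewrite laplace_termM// exprS invfM mulVKf ?gt_eqF// EFinM; over.
have t0 s : 0 < s -> (0 <= (laplace_term s x)%:E)%E.
  by move=> s0; rewrite lee_fin laplace_term_ge0// ltW.
rewrite !nneseriesZl; try by move=> *; exact: t0.
rewrite -ge0_muleDr; try by apply: nneseries_ge0 => *; exact: t0.
congr (_ * _)%E.
rewrite [X in (_ + X)%E]nneseries_recl//; last by move=> *; exact: t0.
rewrite [X in _ = (X + _)%E]nneseries_recl//; last by move=> *; exact: t0.
rewrite expr0 invr1 addeCA addeA; congr (_ + _ + _)%E.
- rewrite -(nneseries_addn 1); last by move=> *; exact: t0.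
  by apply: eq_eseriesr => i _; rewrite addn1.
- rewrite -(nneseries_addn 1); last by move=> *; exact: t0.
  by apply: eq_eseriesr => i _; rewrite addn1.
Qed.

Lemma laplace_series_rhon n x : 0 <= x ->
  laplace_series (rho ^+ n * x) = (((rho ^+ n) `^ p)%:E * laplace_series x)%E.
Proof.
move=> x0; elim: n => [|n ih]; first by rewrite expr0 powR1 mul1r mul1e.
rewrite exprS -mulrA laplace_series_rho ?mulr_ge0 ?(ltW (rhon0 _))//.
by rewrite ih muleA -EFinM powRM ?(ltW (rhon0 _))// ltW.
Qed.

(** Bounding 1 - exp (- s) by 1 at the nonnegative powers gives ratio rho^(- p); bounding it by s at
    the negative powers gives ratio rho^(p - 1). Both are below 1 as 0 < p < 1. *)
Lemma laplace_series1_lty : (laplace_series 1 < +oo)%E.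
Proof.
have geo z (u : nat -> R) : 0 <= z -> z < 1 ->
    (forall k, 0 <= u k) -> (forall k, u k <= z ^+ k) ->
    (\sum_(k <oo) (u k)%:E < +oo)%E.
  move=> z0 z1 u0 uz.
  have := nneseries_geometric z z0 z1; have := ltry (1 - z)^-1; move=> /[swap] <-.
  by apply: le_lt_trans; apply: lee_nneseries => n *; rewrite lee_fin.
have pow_lt1 q : q < 0 -> rho `^ q < 1.
  by move=> q0; rewrite /powR gt_eqF// expR_lt1 nmulr_rlt0// ln_gt0.
apply: lte_add_pinfty.
- apply: (geo (rho `^ - p)).
  + exact: powR_ge0.
  + by rewrite pow_lt1// oppr_lt0.
  + by move=> k; rewrite laplace_term_ge0// ltW.
  + move=> k; rewrite /laplace_term mulr1.
    rewrite -powR_mulrn ?(ltW rho0)// -[leRHS]powR_mulrn ?powR_ge0// powRAC.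
    by rewrite ler_piMr ?powR_ge0// gerDl oppr_le0 expR_ge0.
- apply: (geo (rho `^ (p - 1))).
  + exact: powR_ge0.
  + by rewrite pow_lt1// subr_lt0.
  + by move=> k; rewrite laplace_term_ge0// ltW.
  + move=> k; rewrite /laplace_term mulr1.
    apply: (@le_trans _ _ ((rho `^ (p - 1)) ^+ k.+1)); last first.
      rewrite exprSr ler_piMr ?exprn_ge0 ?powR_ge0// ltW// pow_lt1//.
      by rewrite subr_lt0.
    set s := rho ^- k.+1.
    have -> : (rho `^ (p - 1)) ^+ k.+1 = s `^ (- p) * s.
      rewrite -{2}[s]powRr1 ?(ltW (rhoV0 _))// -powRD ?(lt0r_neq0 (rhoV0 _)) ?implybT//.
      rewrite /s -powR_invn ?(ltW rho0)// -powRrM -powR_mulrn ?powR_ge0// -powRrM.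
      by congr powR; ring.
    rewrite ler_wpM2l ?powR_ge0// lerBlDl -lerBlDr.
    by rewrite -[leLHS]/(1 - s) expR_ge1Dx.
Qed.

Lemma laplace_series1_gt0 : (0 < laplace_series 1)%E.
Proof.
apply: (@lt_le_trans _ _ (laplace_term 1 1)%:E).
  by rewrite lte_fin /laplace_term powR1 !mul1r subr_gt0 expR_lt1 oppr_lt0.
rewrite /laplace_series nneseries_recl//; last first.
  by move=> k _; rewrite lee_fin laplace_term_ge0// ltW.
rewrite expr0 -addeA leeDl// adde_ge0//; apply: nneseries_ge0 => n _ _;
  by rewrite lee_fin laplace_term_ge0// ltW.
Qed.

(** Multiplying by powers of [rho] brings [x] and [y] within a factor [rho] of each other.
    Monotonicity of the series and of the power function then compares them, and homogeneity removes
    the powers. *)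
Lemma laplace_series_powR x y : 0 <= x -> 0 <= y ->
  ((x `^ p)%:E * laplace_series y <=
   (rho `^ p)%:E * ((y `^ p)%:E * laplace_series x))%E.
Proof.
move=> x_ge0; rewrite le_eqVlt => /predU1P[<-|y0].
  rewrite laplace_series0 mule0 powR0 ?gt_eqF// mul0e mule0; exact: lexx.
move: x_ge0; rewrite le_eqVlt => /predU1P[<-|x0].
  by rewrite laplace_series0 !mule0 powR0 ?gt_eqF// mul0e.
(* First [y] is pushed above [x], so that the exponent then needed for [x] is again a natural
   number. *)
have [m] := @exists_ltr_exprn R rho (x / y) rho1; rewrite ltr_pdivrMr// => xm.
have [n ynx xny] : exists2 n, rho ^+ m * y <= rho ^+ n * x &
    rho ^+ n * x <= rho * (rho ^+ m * y).
  have [n0 h0] := @exists_ltr_exprn R rho (rho ^+ m * y / x) rho1.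
  have : exists n, rho ^+ m * y <= rho ^+ n * x.
    by exists n0; rewrite -ler_pdivrMr// ltW.
  (* Minimality of the exponent yields the upper bound; exponent 0 is covered by the choice of
     [m]. *)
  move=> /ex_minnP[[|n] hn mn]; last first.
    exists n.+1 => //; rewrite exprS -mulrA ler_wpM2l ?(ltW rho0)//.
    by rewrite leNgt; apply/negP => /ltW /mn; rewrite ltnn.
  exists 0%N => //; rewrite expr0 mul1r (le_trans (ltW xm))//.
  by rewrite ler_peMl ?(ltW rho1)// mulr_ge0 ?ltW.
have mx n' z : 0 < z -> 0 < rho ^+ n' * z by move=> z0; rewrite mulr_gt0.
have pw (z w : R) : 0 < z -> 0 < w -> (z * w) `^ p = z `^ p * w `^ p.
  by move=> z0 w0; rewrite powRM// ltW.
have := le_laplace_series _ _ (ltW (mx m y y0)) ynx.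
rewrite (laplace_series_rhon _ _ (ltW x0)) (laplace_series_rhon _ _ (ltW y0)) => h1.
have h2 : (rho ^+ n * x) `^ p <= (rho * (rho ^+ m * y)) `^ p.
  by apply: ge0_ler_powR xny; rewrite ?nnegrE ltW// ?mulr_gt0// ?mx.
move: h2; rewrite !pw ?mulr_gt0// => h2.
rewrite -(@lee_pmul2l _ ((rho ^+ m) `^ p)%:E)// ?lte_fin ?powR_gt0//.
rewrite muleCA; apply: (@le_trans _ _
  ((x `^ p)%:E * (((rho ^+ n) `^ p)%:E * laplace_series x))%E).
  by apply: lee_wpmul2l => //; rewrite lee_fin powR_ge0.
rewrite !muleA; apply: lee_wpmul2r; first by rewrite laplace_series_ge0// ltW.
by rewrite -!EFinM lee_fin mulrC (le_trans h2)// mulrA (mulrC (rho `^ p)) -mulrA.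
Qed.

End self_similar_series.

(** * Comparison of moments through Laplace transforms *)

(** The factor [x] cancels from the first inequality when it is positive and finite. If [x] is 0,
    the second inequality forces [a] to be 0; if it is infinite, the third forces [b] to be
    infinite. *)
Lemma lee_cancel_cross {R : realType} (k : R) (a b x l : \bar R) :
  0 < k -> (0 <= a)%E -> (0 <= b)%E -> (0 <= x)%E -> (0 < l)%E -> (l < +oo)%E ->
  (a * x <= k%:E * b * x)%E -> (a * l <= k%:E * x)%E -> (x <= k%:E * l * b)%E ->
  (a <= k%:E * b)%E.
Proof.
move=> k0 a0 b0; rewrite le_eqVlt => /predU1P[<- l0 _ _ ax _|x0 l0 l1 axb _ xb].
  suff -> : a = 0%E by rewrite mule_ge0// lee_fin ltW.
  apply/eqP; rewrite eq_le a0 andbT -(pmule_lle0 _ l0).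
  by rewrite (le_trans ax)// mule0.
have [xoo|] := eqVneq x +oo%E.
  suff -> : b = +oo%E by rewrite gt0_muley ?leey// lte_fin.
  apply/eqP; rewrite -leye_eq leNgt; apply/negP => by_.
  have : (k%:E * l * b < +oo)%E.
    rewrite lte_mul_pinfty//; first by apply: mule_ge0; rewrite ?lee_fin ltW.
    by rewrite fin_numM// ge0_fin_numE// ltW.
  by rewrite ltNge -xoo xb.
rewrite -ltey => x1.
by rewrite -(@lee_pmul2r _ x)// ge0_fin_numE// ltW.
Qed.

Section laplace_moment.
Local Open Scope ereal_scope.
Context {d} {T : measurableType d} {R : realType} (P : probability T R).

Lemma integral_1Bexp (X : T -> R) : measurable_fun setT X ->
  (forall w, 0 <= X w)%R ->
  \int[P]_w (1 - expR (- X w))%:E = 1 - \int[P]_w (expR (- X w))%:E.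
Proof.
move=> mX X0.
have mE : measurable_fun setT (fun w => expR (- X w)).
  by apply: measurableT_comp => //; exact: measurableT_comp.
have e1 w : (expR (- X w) <= 1)%R by rewrite expR_le1 oppr_le0.
have fin : \int[P]_w (expR (- X w))%:E \is a fin_num.
  rewrite ge0_fin_numE; last first.
    by apply: integral_ge0 => w _; rewrite lee_fin expR_ge0.
  apply: (@le_lt_trans _ _ (\int[P]_w (cst 1 w))).
    apply: ge0_le_integral => //; first exact/measurable_EFinP.
    by move=> w _; rewrite lee_fin.
  by rewrite integral_cst//= probability_setT mule1 ltry.
rewrite -[LHS](addeK _ fin) -ge0_integralD//.
- under eq_integral do rewrite -EFinD subrK.
  by rewrite integral_cst//= probability_setT mule1.
- by move=> w _; rewrite lee_fin subr_ge0.
- by apply/measurable_EFinP; exact: measurable_funB.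
- exact/measurable_EFinP.
Qed.

Lemma integral_scaled_le (f g : T -> \bar R) (c k : \bar R) :
  0 <= c -> 0 <= k ->
  measurable_fun setT f -> measurable_fun setT g ->
  (forall w, 0 <= f w) -> (forall w, 0 <= g w) ->
  (forall w, f w * c <= k * g w) ->
  \int[P]_w f w * c <= k * \int[P]_w g w.
Proof.
move=> c0 k0 mf mg f0 g0 fg.
rewrite -ge0_integralZr// -ge0_integralZl//; apply: ge0_le_integral.
- exact: measurableT.
- by move=> w _; rewrite mule_ge0.
- exact: emeasurable_funM.
- exact: emeasurable_funM.
- by move=> w _; exact: fg.
Qed.

(** The variables [w] and [v] are integrated one after the other, as for two independent outcomes;
    each integration only pulls constants out. *)
Lemma integral_cross_le (f g F G : T -> \bar R) (k : \bar R) : 0 <= k ->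
  measurable_fun setT f -> measurable_fun setT g ->
  measurable_fun setT F -> measurable_fun setT G ->
  (forall w, 0 <= f w) -> (forall w, 0 <= g w) ->
  (forall w, 0 <= F w) -> (forall w, 0 <= G w) ->
  (forall w v, f w * G v <= k * F v * g w) ->
  \int[P]_w f w * \int[P]_w G w <= k * \int[P]_w F w * \int[P]_w g w.
Proof.
move=> k0 mf mg mF mG f0 g0 F0 G0 fG.
have If0 : 0 <= \int[P]_w f w by exact: integral_ge0.
have Ig0 : 0 <= \int[P]_w g w by exact: integral_ge0.
rewrite muleC [leRHS]muleAC.
apply: integral_scaled_le => //; first exact: mule_ge0.
move=> v; rewrite muleC muleAC.
apply: integral_scaled_le => //; first exact: mule_ge0.
Qed.

Section comparison.
Local Open Scope ring_scope.
Variables (p rho : R) (X Y : T -> R).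
Hypotheses (p0 : 0 < p) (p1 : p < 1) (rho1 : 1 < rho).
Hypotheses (mX : measurable_fun setT X) (mY : measurable_fun setT Y).
Hypotheses (X0 : forall w, 0 <= X w) (Y0 : forall w, 0 <= Y w).

Let measurable_laplace_term (Z : T -> R) s : measurable_fun setT Z ->
  measurable_fun setT (fun w => (laplace_term p s (Z w))%:E).
Proof.
move=> mZ; apply/measurable_EFinP; apply: measurable_funM => //.
apply: measurable_funB => //; apply: measurableT_comp => //.
by apply: measurableT_comp => //; apply: measurable_funM.
Qed.

Let rho0 : 0 < rho. Proof. exact: lt_trans rho1. Qed.
Let rhon0 n : 0 < rho ^+ n. Proof. exact: exprn_gt0. Qed.
Let rhoV0 n : 0 < rho ^- n. Proof. by rewrite invr_gt0. Qed.

Let term0 (Z : T -> R) s w : (forall w, 0 <= Z w) -> 0 < s ->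
  (0 <= (laplace_term p s (Z w))%:E)%E.
Proof. by move=> Z0 s0; rewrite lee_fin laplace_term_ge0// ltW. Qed.

Let measurable_laplace_series (Z : T -> R) : measurable_fun setT Z ->
  (forall w, 0 <= Z w) ->
  measurable_fun setT (fun w => laplace_series p rho (Z w)).
Proof.
move=> mZ Z0; apply: emeasurable_funD.
- apply: ge0_emeasurable_sum => [k w _ _|k _]; first exact: term0.
  exact: measurable_laplace_term.
- apply: ge0_emeasurable_sum => [k w _ _|k _]; first exact: term0.
  exact: measurable_laplace_term.
Qed.

Let integral_laplace_term (Z : T -> R) s : measurable_fun setT Z ->
  (forall w, 0 <= Z w) -> 0 < s ->
  (\int[P]_w (laplace_term p s (Z w))%:E =
   (s `^ (- p))%:E * (1 - \int[P]_w (expR (- (s * Z w)))%:E))%E.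
Proof.
move=> mZ Z0 s0.
have msZ : measurable_fun setT (fun w => s * Z w) by exact: measurable_funM.
have sZ0 w : 0 <= s * Z w by rewrite mulr_ge0// ltW.
rewrite -integral_1Bexp// -ge0_integralZl//.
- apply/measurable_EFinP; apply: measurable_funB => //.
  by apply: measurableT_comp => //; exact: measurableT_comp.
- by move=> w _; rewrite lee_fin subr_ge0 expR_le1 oppr_le0.
- by rewrite lee_fin powR_ge0.
Qed.

Let integral_laplace_series (Z : T -> R) : measurable_fun setT Z ->
  (forall w, 0 <= Z w) ->
  (\int[P]_w laplace_series p rho (Z w) =
   \sum_(k <oo) \int[P]_w (laplace_term p (rho ^+ k) (Z w))%:E +
   \sum_(k <oo) \int[P]_w (laplace_term p (rho ^- k.+1) (Z w))%:E)%E.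
Proof.
move=> mZ Z0; rewrite ge0_integralD//.
- by rewrite !integral_nneseries// => *; (exact: term0 || exact: measurable_laplace_term).
- by move=> w _; apply: nneseries_ge0 => k _ _; exact: term0.
- apply: ge0_emeasurable_sum => [k w _ _|k _]; first exact: term0.
  exact: measurable_laplace_term.
- by move=> w _; apply: nneseries_ge0 => k _ _; exact: term0.
- apply: ge0_emeasurable_sum => [k w _ _|k _]; first exact: term0.
  exact: measurable_laplace_term.
Qed.

(* Integrating [x^p phi(y) <= rho^p y^p phi(x)] in [x] and in [y], where [phi]
   is [laplace_series], reduces the claim to [E phi(X) = E phi(Y)], which only
   involves Laplace transforms. *)
Lemma le_moment_of_laplace :
  (forall s : R, (0 < s)%R -> \int[P]_w (expR (- (s * X w)))%:E =
                      \int[P]_w (expR (- (s * Y w)))%:E)%E ->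
  (\int[P]_w (X w `^ p)%:E <= (rho `^ p)%:E * \int[P]_w (Y w `^ p)%:E)%E.
Proof.
move=> XY.
have phi0 (Z : T -> R) w : (forall w, 0 <= Z w) ->
    (0 <= laplace_series p rho (Z w))%E.
  by move=> Z0; exact: laplace_series_ge0.
have mp (Z : T -> R) : measurable_fun setT Z ->
    measurable_fun setT (fun w => (Z w `^ p)%:E).
  by move=> mZ; apply/measurable_EFinP; exact: (measurableT_comp (measurable_powR p) mZ).
have pw0 (Z : T -> R) w : (0 <= (Z w `^ p)%:E)%E by rewrite lee_fin powR_ge0.
have phiX w : (0 <= laplace_series p rho (X w))%E by exact: phi0.
have phiY w : (0 <= laplace_series p rho (Y w))%E by exact: phi0.
have mX' := mp _ mX; have mY' := mp _ mY.
have mphiX := measurable_laplace_series _ mX X0.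
have mphiY := measurable_laplace_series _ mY Y0.
have phiX0 : (0 <= \int[P]_w laplace_series p rho (X w))%E.
  by apply: integral_ge0 => w _; exact: phi0.
have EX0 : (0 <= \int[P]_w (X w `^ p)%:E)%E by apply: integral_ge0 => w _.
have EY0 : (0 <= \int[P]_w (Y w `^ p)%:E)%E by apply: integral_ge0 => w _.
have cross x y : 0 <= x -> 0 <= y ->
    ((x `^ p)%:E * laplace_series p rho y <=
     (rho `^ p)%:E * (y `^ p)%:E * laplace_series p rho x)%E.
  by move=> x0 y0; rewrite -muleA; exact: laplace_series_powR.
have r0 : (0 <= (rho `^ p)%:E)%E by rewrite lee_fin powR_ge0.
have step := integral_cross_le _ _ _ _ _ r0 mX' mphiX mY' mphiY
  (pw0 X) phiX (pw0 Y) phiY (fun w v => cross _ _ (X0 w) (Y0 v)).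
have phiXY : (\int[P]_w laplace_series p rho (X w) =
              \int[P]_w laplace_series p rho (Y w))%E.
  rewrite (integral_laplace_series X mX X0) (integral_laplace_series Y mY Y0).
  apply: f_equal2; apply: eq_eseriesr => k _.
  - rewrite (integral_laplace_term X _ mX X0 (rhon0 k)).
    by rewrite (integral_laplace_term Y _ mY Y0 (rhon0 k)) XY.
  - rewrite (integral_laplace_term X _ mX X0 (rhoV0 k.+1)).
    by rewrite (integral_laplace_term Y _ mY Y0 (rhoV0 k.+1)) XY.
have phi1_gt0 := laplace_series1_gt0 p rho rho1.
(* Setting one variable to 1 in [cross] gives the two inequalities that settle the cases where E
   phi(X) is 0 or infinite. *)
have stepX : (\int[P]_w (X w `^ p)%:E * laplace_series p rho 1 <=
    (rho `^ p)%:E * \int[P]_w laplace_series p rho (X w))%E.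
  apply: (integral_scaled_le _ _ _ _ (ltW phi1_gt0) r0 mX' mphiX (pw0 X) phiX).
  by move=> w; have := cross (X w) 1 (X0 w) ler01; rewrite powR1 mule1.
have stepY : (\int[P]_w laplace_series p rho (Y w) * 1 <=
    (rho `^ p)%:E * laplace_series p rho 1 * \int[P]_w (Y w `^ p)%:E)%E.
  apply: (integral_scaled_le _ _ _ _ lee01 (mule_ge0 r0 (ltW phi1_gt0))
    mphiY mY' phiY (pw0 Y)).
  move=> w; have := cross 1 (Y w) ler01 (Y0 w).
  by rewrite powR1 mul1e mule1 muleAC.
have phi1_lty := laplace_series1_lty p rho p0 p1 rho1.
rewrite -phiXY in step; rewrite mule1 -phiXY in stepY.
have rho_gt0 : 0 < rho `^ p by rewrite powR_gt0.
exact: (lee_cancel_cross _ _ _ _ _ rho_gt0 EX0 EY0 phiX0 phi1_gt0 phi1_lty step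
  stepX stepY).
Qed.

End comparison.
End laplace_moment.

(** * Geometric bounds and dyadic subdivision *)

(** The factor [e] stands for the moment of S_1, which may a priori be infinite; the right-hand side
    is then infinite too, because a / (1 - r) is positive. *)
Lemma nneseries_geometricMr_le {R : realType} (a r : R) (e : \bar R) :
  0 < a -> 0 <= r -> r < 1 -> (0 <= e)%E ->
  (\sum_(n <oo) ((a * r ^+ n)%:E * e) <= (a / (1 - r))%:E * e)%E.
Proof.
move=> a0 r0 r1; have d0 : 0 < a / (1 - r) by rewrite divr_gt0// subr_gt0.
case: e => [x x0| _ |//]; last by rewrite gt0_muley ?leey// lte_fin.
rewrite (eq_eseriesr (g := fun n => (a * x)%:E * (r ^+ n)%:E)%E); last first.
  by move=> n _; rewrite -!EFinM mulrAC.
rewrite nneseriesZl; last by move=> n _; rewrite lee_fin exprn_ge0.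
rewrite nneseries_geometric// -EFinM lee_fin.
by rewrite mulrAC.
Qed.

Lemma exists_halving_lt {R : realType} (T t : R) :
  0 < t -> exists n, T * 2^-1 ^+ n < t.
Proof.
move=> t0; have [n] := @exists_ltr_exprn R 2 (T / t) (ltr1n _ 2).
rewrite ltr_pdivrMr// => h; exists n.
by rewrite exprVn ltr_pdivrMr ?exprn_gt0// mulrC.
Qed.

Lemma powR_halving {R : realType} (T q : R) n : 0 <= T ->
  (T * 2^-1 ^+ n) `^ q = T `^ q * (2 `^ (- q)) ^+ n.
Proof.
move=> T0; rewrite powRM ?exprn_ge0 ?invr_ge0//; congr (_ * _).
rewrite exprVn -powR_invn// -powRrM -powR_mulrn ?powR_ge0// -powRrM.
by congr powR; ring.
Qed.

Lemma powR2N_lt1 {R : realType} (q : R) : 0 < q -> 2 `^ (- q) < 1 :> R.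
Proof.
move=> q0; rewrite /powR pnatr_eq0/= expR_lt1 nmulr_rlt0 ?oppr_lt0//.
by rewrite ln_gt0// ltr1n.
Qed.

(** * Moment bounds for integrals against a stable subordinator *)

Section stable_process.
Context {R : realType} {d : measure_display} {Omega : measurableType d}
  {P : probability Omega R}.
Context {alpha : R} {S : R -> {RV P >-> R}}.
Hypotheses (alpha_gt0 : 0 < alpha) (hS : stable_subordinator alpha S).

Lemma ae_regular_path :
  {ae P, forall w, cadlag (fun t => S t w) /\ increasing_path (fun t => S t w)}.
Proof.
have := levy_cadlag (subordinator_levy hS).
apply: filterS2 (subordinator_increasing hS) => w; by split.
Qed.

Let measurable_pos t : measurable_fun setT (fun w => Num.max (S t w) 0).
Proof. exact: measurable_maxr. Qed.

Let pos_ge0 t w : 0 <= Num.max (S t w) 0.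
Proof. by rewrite le_max lexx orbT. Qed.

(** S_t is nonnegative only almost surely; its positive part is a version that is nonnegative at
    every outcome, as the Laplace comparison requires. *)
Lemma ae_max_subordinator t : 0 <= t -> {ae P, forall w, Num.max (S t w) 0 = S t w}.
Proof. by move=> t0; apply: filterS (subordinator_ge0 hS) => w /(_ t t0)/max_l. Qed.

Lemma laplace_max_subordinator lambda t : 0 < lambda -> 0 <= t ->
  (\int[P]_w (expR (- (lambda * Num.max (S t w) 0)))%:E =
   (expR (- (lambda `^ alpha * t)))%:E)%E.
Proof.
move=> l0 t0; rewrite -mulNr -(subordinator_laplace hS l0 t0) unlock.
have mE (Z : Omega -> R) : measurable_fun setT Z ->
    measurable_fun setT (fun w => (expR (- lambda * Z w))%:E).
  move=> mZ; apply/measurable_EFinP; apply: measurableT_comp => //.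
  exact: measurable_funM.
under eq_integral do rewrite -mulNr.
apply: ge0_ae_eq_integral => //.
- exact: mE.
- exact: mE.
- apply: filterS (ae_max_subordinator t t0) => w h _.
  by rewrite h.
Qed.

Let measurable_powR_comp p (Z : Omega -> R) : measurable_fun setT Z ->
  measurable_fun setT (fun w => (Z w `^ p)%:E).
Proof.
by move=> mZ; apply/measurable_EFinP; exact: (measurableT_comp (measurable_powR p) mZ).
Qed.

(** S_t and t^(1/alpha) S_1 have the same Laplace transform, since (s t^(1/alpha))^alpha = s^alpha
    t. Comparing their moments with rho = 2^(1/alpha) costs the factor rho^p = 2^(p/alpha). *)
Lemma moment_subordinator_scaling p t : p < 1 -> 0 < p -> 0 < t ->
  (\int[P]_w (S t w `^ p)%:E <=
   (2 `^ (p / alpha) * t `^ (p / alpha))%:E * \int[P]_w (S 1 w `^ p)%:E)%E.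
Proof.
move=> p1 p0 t0.
have maxE u : 0 <= u -> (\int[P]_w (S u w `^ p)%:E =
    \int[P]_w (Num.max (S u w) 0 `^ p)%:E)%E.
  move=> u0; apply: ge0_ae_eq_integral => //.
  - exact: measurable_powR_comp.
  - exact: measurable_powR_comp.
  - by move=> w _; rewrite lee_fin powR_ge0.
  - by move=> w _; rewrite lee_fin powR_ge0.
  - by apply: filterS (ae_max_subordinator u u0) => w -> _.
have c0 : 0 < t `^ alpha^-1 by rewrite powR_gt0.
have rho1 : 1 < 2 `^ alpha^-1 :> R.
  by rewrite /powR pnatr_eq0/= expR_gt1 mulr_gt0 ?invr_gt0 ?ln_gt0 ?ltr1n.
rewrite (maxE t (ltW t0)) (maxE 1 ler01) EFinM -muleA.
have -> : ((t `^ (p / alpha))%:E * \int[P]_w (Num.max (S 1 w) 0 `^ p)%:E =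
    \int[P]_w ((t `^ alpha^-1 * Num.max (S 1 w) 0) `^ p)%:E)%E.
  under [RHS]eq_integral do
    rewrite powRM ?(ltW c0)// -powRrM [_^-1 * _]mulrC EFinM.
  rewrite ge0_integralZl//.
  - exact: measurable_powR_comp.
  - by move=> w _; rewrite lee_fin powR_ge0.
  - by rewrite lee_fin powR_ge0.
rewrite [p / alpha]mulrC powRrM.
apply: (le_moment_of_laplace P p _ _ _ p0 p1 rho1 (measurable_pos t) _ (pos_ge0 t)).
- exact: measurable_funM.
- by move=> w; rewrite mulr_ge0// ltW.
- move=> s s0; rewrite laplace_max_subordinator ?(ltW t0)//.
  under [RHS]eq_integral do rewrite mulrA.
  rewrite laplace_max_subordinator ?mulr_gt0// mulr1 powRM ?(ltW s0) ?(ltW c0)//.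
  by rewrite -powRrM mulVf ?gt_eqF// powRr1// ltW.
Qed.

Lemma integral_increment (g : R -> \bar R) s t :
  measurable_fun setT g -> (forall x, 0 <= g x)%E -> 0 <= s -> s <= t ->
  (\int[P]_w g (S t w - S s w)%R = \int[P]_w g (S (t - s) w))%E.
Proof.
move=> mg g0 s0 st.
have h0 : 0 <= t - s by rewrite subr_ge0.
have E := levy_stationary (subordinator_levy hS) s0 h0.
transitivity (\int[distribution P (increment S s (s + (t - s)))]_x g x)%E.
  by rewrite subrKC ge0_integral_distribution.
rewrite -[RHS](@ge0_integral_distribution _ _ _ _ _ P (S (t - s)) g)//.
by apply: eq_measure_integral => A mA _; exact: E.
Qed.

Lemma le_moment_subordinator p s t : 0 <= p -> 0 <= s -> s <= t ->
  (\int[P]_w (S s w `^ p)%:E <= \int[P]_w (S t w `^ p)%:E)%E.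
Proof.
move=> p0 s0 st; apply: ae_ge0_le_integral => //.
- by move=> w _; rewrite lee_fin powR_ge0.
- exact: measurable_powR_comp.
- by move=> w _; rewrite lee_fin powR_ge0.
- exact: measurable_powR_comp.
- apply: filterS2 (subordinator_ge0 hS) (subordinator_increasing hS) => w h0 hi _.
  rewrite lee_fin ge0_ler_powR// ?nnegrE ?h0 ?(le_trans s0)//.
  exact: hi.
Qed.

(** The path integral is dominated by a series of increments, subadditivity moves the power inside
    the series, and stationarity replaces each increment by the value of [S] at its length. *)
Lemma moment_integral_dS_le (f : R -> R) (u c : nat -> R) (p : R) :
  measurable_fun setT f -> (forall x, 0 <= f x) ->
  (forall n, 0 <= u n) -> (forall n, u n.+1 <= u n) ->
  (forall t, 0 < t -> exists n, u n < t) ->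
  (forall n, 0 <= c n) ->
  (forall n t, u n.+1 < t -> t <= u n -> f t <= c n) -> 0 < p -> p <= 1 ->
  (\int[P]_w (integral_dS S f (u 0%N) w `^ p) <=
   \sum_(n <oo) ((c n `^ p)%:E * \int[P]_w (S (u n - u n.+1) w `^ p)%:E))%E.
Proof.
move=> mf f0 u0 du u_lt c0 fc p0 p1.
pose g n w : \bar R := (c n `^ p * (S (u n) w - S (u n.+1) w) `^ p)%:E.
have g0 n w : (0 <= g n w)%E by rewrite lee_fin mulr_ge0 ?powR_ge0.
have mD n : measurable_fun setT (fun w => S (u n) w - S (u n.+1) w).
  exact: measurable_funB.
have mg n : measurable_fun setT (g n).
  apply/measurable_EFinP; apply: measurable_funM => //.
  exact: (measurableT_comp (measurable_powR p) (mD n)).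
apply: (@le_trans _ _ (\int[P]_w \sum_(n <oo) g n w)%E).
  apply: ae_le_integral_measurable_bound.
  - by move=> w; exact: poweR_ge0.
  - by move=> w; apply: nneseries_ge0 => n _ _.
  - by apply: ge0_emeasurable_sum.
  apply: filterS ae_regular_path => w [Fc Fi].
  have D0 n : 0 <= S (u n) w - S (u n.+1) w by rewrite subr_ge0; exact: Fi.
  under eq_eseriesr do rewrite /g -powRM//.
  apply: le_trans (poweR_nneseries_le p p0 p1
    (fun n => c n * (S (u n) w - S (u n.+1) w)) _).
    apply: gt0_ler_poweR; first exact: ltW.
    - by rewrite in_itv/= leey andbT path_integral_ge0.
    - rewrite in_itv/= leey andbT; apply: nneseries_ge0 => n _ _.
      by rewrite lee_fin mulr_ge0.
    - exact: (path_integral_le _ _ Fc Fi mf f0 u u0 du u_lt).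
  by move=> n; rewrite mulr_ge0.
rewrite integral_nneseries//; apply: lee_nneseries => [n _ _|n _].
  exact: integral_ge0.
rewrite /g; under eq_integral do rewrite EFinM.
rewrite ge0_integralZl; last 4 first.
- exact: measurableT.
- exact: measurable_powR_comp.
- by move=> w _; rewrite lee_fin powR_ge0.
- by rewrite lee_fin powR_ge0.
rewrite (integral_increment (fun x => (x `^ p)%:E))//.
  by apply/measurable_EFinP; exact: measurable_powR.
by move=> x; rewrite lee_fin powR_ge0.
Qed.

Lemma moment_integral_powR theta p T : 0 < theta -> theta < alpha^-1 ->
  0 < p -> p < alpha -> alpha < 1 -> 0 < T ->
  (\int[P]_w (integral_dS S (fun t => t `^ (- theta))%R T w `^ p) <=
   (2 `^ (p / alpha + p * theta) / (2 `^ (p / alpha) - 2 `^ (p * theta)) *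
    T `^ ((alpha^-1 - theta) * p))%:E * \int[P]_w (S 1 w `^ p)%:E)%E.
Proof.
move=> th0 th1 p0 pa a1 T0; have p1 := lt_trans pa a1.
pose u n := T * 2^-1 ^+ n.
have u_gt0 n : 0 < u n by rewrite mulr_gt0// exprn_gt0// invr_gt0.
(* Halving makes the length of a piece equal to its left endpoint, where the decreasing integrand is
   largest; length and weight thus combine into one power of [u n.+1]. *)
have uD n : u n - u n.+1 = u n.+1 by rewrite /u exprS; field.
have du n : u n.+1 <= u n by rewrite -subr_ge0 uD ltW.
have uT : u 0%N = T by rewrite /u mulr1.
rewrite -{1}uT.
apply: le_trans.
  apply: (@moment_integral_dS_le (fun t => t `^ (- theta)) u
    (fun n => u n.+1 `^ (- theta)) p).
- exact: measurable_powR.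
- by move=> x; exact: powR_ge0.
- by move=> n; exact: ltW.
- exact: du.
- by move=> t; exact: exists_halving_lt.
- by move=> n; exact: powR_ge0.
- move=> n t ut _; have t0 := lt_trans (u_gt0 n.+1) ut.
  rewrite !powRN lef_pV2 ?posrE ?powR_gt0// ge0_ler_powR ?nnegrE//; exact: ltW.
- exact: p0.
- exact: ltW.
set E := (\int[P]_w (S 1 w `^ p)%:E)%E.
have E0 : (0 <= E)%E by apply: integral_ge0 => w _; rewrite lee_fin powR_ge0.
(* The n-th term is 2^(p/alpha) (u n.+1)^q times the moment of S_1, and theta < 1/alpha makes q
   positive, so the series has ratio 2^(- q) < 1. *)
set q := p / alpha - p * theta.
have q0 : 0 < q by rewrite /q -mulrBr mulr_gt0// subr_gt0.
pose r : R := 2 `^ (- q).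
have r0 : 0 < r by rewrite powR_gt0.
have r1 : r < 1 by exact: powR2N_lt1.
have uq n : u n.+1 `^ q = T `^ q * r ^+ n.+1 by exact/powR_halving/ltW.
apply: (@le_trans _ _ (\sum_(n <oo) (2 `^ (p / alpha) * T `^ q * r * r ^+ n)%:E * E)%E).
  apply: lee_nneseries => [n _ _|n _].
    apply: mule_ge0; first by rewrite lee_fin powR_ge0.
    by apply: integral_ge0 => w _; rewrite lee_fin powR_ge0.
  apply: le_trans (lee_wpmul2l _ (moment_subordinator_scaling p _ p1 p0 _)) _.
  - by rewrite lee_fin powR_ge0.
  - by rewrite uD.
  rewrite muleA -EFinM uD -powRrM mulrCA -powRD ?(lt0r_neq0 (u_gt0 _)) ?implybT//.
  rewrite (_ : - theta * p + p / alpha = q); last by rewrite /q; ring.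
  by rewrite uq exprS !mulrA.
have A0 : 0 < 2 `^ (p / alpha) * T `^ q * r by rewrite !mulr_gt0 ?powR_gt0.
apply: le_trans (nneseries_geometricMr_le _ _ _ A0 (ltW r0) r1 E0) _.
apply: lee_wpmul2r => //; rewrite lee_fin.
rewrite (_ : (alpha^-1 - theta) * p = q); last by rewrite /q; ring.
rewrite mulrAC -!mulrA [T `^ q * _]mulrC !mulrA ler_wpM2r ?powR_ge0//.
rewrite /r /q opprB powRB ?pnatr_eq0 ?implybT// powRD ?pnatr_eq0 ?implybT//.
(* With r = y / x, the constant is x r / (1 - r) = x y / (x - y), an exact identity. *)
set x := 2 `^ (p / alpha); set y := 2 `^ (p * theta).
have x0 : 0 < x by rewrite powR_gt0.
have xy : y < x.
  rewrite /x /y /powR pnatr_eq0/= ltr_expR ltr_pM2r ?ln_gt0 ?ltr1n//.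
  by rewrite -subr_gt0.
rewrite le_eqVlt; apply/orP; left; apply/eqP.
field.
by rewrite subr_eq0 !gt_eqF//.
Qed.

(** Going back from T in unit steps, the integrand is at most exp (- lambda n) on the n-th piece.
    Each piece has length at most 1, so its moment is at most that of S_1, and the ratio is exp (- p
    lambda). *)
Lemma moment_integral_expR lambda p T : 0 < lambda ->
  0 < p -> p <= 1 -> 0 < T ->
  (\int[P]_w (integral_dS S (fun t => expR (- (lambda * (T - t))))%R T w `^ p) <=
   (expR (p * lambda) / (expR (p * lambda) - 1))%:E *
     \int[P]_w (S 1 w `^ p)%:E)%E.
Proof.
move=> l0 p0 p1 T0.
pose u n := Num.max (T - n%:R) 0.
have u_ge0 n : 0 <= u n by rewrite le_max lexx orbT.
have du n : u n.+1 <= u n.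
  by rewrite ge_max !le_max lexx orbT andbT lerD2l lerN2 ler_nat leqnSn.
have uD n : u n - u n.+1 <= 1.
  rewrite lerBlDr ge_max addr_ge0// andbT -lerBlDl le_max -natr1.
  by rewrite opprD addrA lexx.
have uT : u 0%N = T by rewrite /u subr0 max_l// ltW.
rewrite -{2}uT.
apply: le_trans.
  apply: (@moment_integral_dS_le (fun t => expR (- (lambda * (T - t)))) u
    (fun n => expR (- (lambda * n%:R))) p).
- apply: measurableT_comp => //; apply: measurableT_comp => //.
  by apply: measurable_funM => //; exact: measurable_funB.
- by move=> x; exact: expR_ge0.
- exact: u_ge0.
- exact: du.
- move=> t t0; exists (Num.bound T); rewrite /u gt_max t0 andbT.
  by rewrite (le_lt_trans _ t0)// subr_le0 ltW// archi_boundP// ltW.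
- by move=> n; exact: expR_ge0.
- move=> n t ut tu; rewrite ler_expR lerN2 ler_wpM2l ?(ltW l0)//.
  have t0 := le_lt_trans (u_ge0 n.+1) ut.
  (* Where the maximum is 0 the piece is empty, since [t] is positive. *)
  move: tu; rewrite le_max => /orP[|/(lt_le_trans t0)]; last by rewrite ltxx.
  by lra.
- exact: p0.
- exact: p1.
set E := (\int[P]_w (S 1 w `^ p)%:E)%E.
have E0 : (0 <= E)%E by apply: integral_ge0 => w _; rewrite lee_fin powR_ge0.
pose r := expR (- (p * lambda)).
have r1 : r < 1 by rewrite expR_lt1 oppr_lt0 mulr_gt0.
apply: (@le_trans _ _ (\sum_(n <oo) (1 * r ^+ n)%:E * E)%E).
  apply: lee_nneseries => [n _ _|n _].
    apply: mule_ge0; first by rewrite lee_fin powR_ge0.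
    by apply: integral_ge0 => w _; rewrite lee_fin powR_ge0.
  rewrite mul1r /r -expRM_natr -expRM.
  rewrite (_ : - (lambda * _) * p = - (p * lambda) * n%:R); last by ring.
  apply: lee_wpmul2l; first by rewrite lee_fin expR_ge0.
  by apply: le_moment_subordinator; rewrite ?(ltW p0) ?subr_ge0.
apply: le_trans (nneseries_geometricMr_le _ _ _ ltr01 (expR_ge0 _) r1 E0) _.
apply: lee_wpmul2r => //; rewrite lee_fin /r expRN.
have x1 : 1 < expR (p * lambda) by rewrite expR_gt1 mulr_gt0.
rewrite le_eqVlt; apply/orP; left; apply/eqP.
field.
by rewrite subr_eq0 !gt_eqF// expR_gt0.
Qed.

End stable_process.

(** * Almost sure finiteness below the critical exponent *)

Lemma nneseries_pinfty_often {R : realType} (x : nat -> R) (e : R) : 0 < e ->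
  (forall n, 0 <= x n) -> (forall N, exists2 n, (N <= n)%N & e < x n) ->
  (\sum_(n <oo) (x n)%:E = +oo)%E.
Proof.
move=> e0 x0 xe; apply/eqP; rewrite -leye_eq leNgt; apply/negP => xoo.
have /cvg_series_cvg_0/cvgr_lt/(_ _ e0)[N _ hN] := nnseries_is_cvg x0 xoo.
have [n Nn] := xe N.
by apply/negP; rewrite -leNgt ltW//; exact: hN.
Qed.

Lemma nneseries_lty_of_1Bexp {R : realType} (x : nat -> R) :
  (forall n, 0 <= x n) ->
  (\sum_(n <oo) (1 - expR (- x n))%:E < +oo)%E ->
  (\sum_(n <oo) (x n)%:E < +oo)%E.
Proof.
move=> x0 hx; pose y n := 1 - expR (- x n).
have y0 n : 0 <= y n by rewrite subr_ge0 expR_le1 oppr_le0.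
have half0 : 0 < 2^-1 :> R by rewrite invr_gt0.
have /cvg_series_cvg_0/cvgr_lt/(_ _ half0)[N _ hN] := nnseries_is_cvg y0 hx.
rewrite (nneseries_split 0%N N); last by move=> k _; rewrite lee_fin.
rewrite add0n sumEFin; apply: lte_add_pinfty; first exact: ltry.
rewrite -nneseries_addn; last by move=> k; rewrite lee_fin.
apply: (@le_lt_trans _ _ (\sum_(n <oo) (2%:E * (y (n + N)%N)%:E))%E).
  apply: lee_nneseries => [n _ _|n _]; first by rewrite lee_fin.
  rewrite -EFinM lee_fin.
  (* Here exp (- x) > 1/2, and 1 + x <= exp x gives x exp (- x) <= 1 - exp (- x); hence x <= 2 (1 -
     exp (- x)). *)
  have := hN (n + N)%N (leq_addl _ _); rewrite /y /= => h.
  have e1 := expR_ge1Dx (x (n + N)%N).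
  have e2 := expRxMexpNx_1 (x (n + N)%N).
  have e3 := expR_gt0 (- x (n + N)%N).
  have x1 := x0 (n + N)%N.
  nra.
rewrite nneseriesZl; last by move=> n _; rewrite lee_fin.
apply: lte_mul_pinfty; [by rewrite lee_fin|by []|].
rewrite (nneseries_addn (f := fun n => (y n)%:E)); last by move=> n; rewrite lee_fin.
apply: le_lt_trans hx; rewrite [leRHS](nneseries_split 0%N N); last first.
  by move=> n _; rewrite lee_fin; exact: y0.
by rewrite add0n leeDr// sume_ge0// => n _; rewrite lee_fin; exact: y0.
Qed.

Lemma ae_lty_of_integral {d} {T : measurableType d} {R : realType}
    (mu : {measure set T -> \bar R}) (f : T -> \bar R) :
  measurable_fun setT f -> (forall x, 0 <= f x)%E ->
  (\int[mu]_x f x < +oo)%E -> {ae mu, forall x, (f x < +oo)%E}.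
Proof.
move=> mf f0 foo.
have fint : mu.-integrable setT f.
  apply/integrableP; split => //.
  by under eq_integral do rewrite gee0_abs//.
apply: filterS (integrable_ae measurableT fint) => x /(_ I).
by rewrite ge0_fin_numE.
Qed.

Section path_finiteness.
Context {R : realType} {d : measure_display} {Omega : measurableType d}
  {P : probability Omega R}.
Context {alpha : R} {S : R -> {RV P >-> R}}.
Hypotheses (alpha_gt0 : 0 < alpha) (hS : stable_subordinator alpha S).

(** By the Laplace transform, 1 - exp (- c S_u) has expectation 1 - exp (- c^alpha u), at most
    c^alpha u. The series of these variables is thus integrable, hence almost surely finite. *)
Lemma ae_subordinator_series_lty (c u : nat -> R) :
  (forall n, 0 < c n) -> (forall n, 0 <= u n) ->
  (\sum_(n <oo) (c n `^ alpha * u n)%:E < +oo)%E ->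
  {ae P, forall w, (\sum_(n <oo) (c n * Num.max (S (u n) w) 0)%:E < +oo)%E}.
Proof.
move=> c0 u0 cu.
pose x n w := c n * Num.max (S (u n) w) 0.
have x0 n w : 0 <= x n w by rewrite mulr_ge0 ?(ltW (c0 n))// le_max lexx orbT.
have mx n : measurable_fun setT (x n).
  by apply: measurable_funM => //; exact: measurable_maxr.
pose y n w := (1 - expR (- x n w))%:E.
have y0 n w : (0 <= y n w)%E by rewrite lee_fin subr_ge0 expR_le1 oppr_le0.
have my n : measurable_fun setT (y n).
  apply/measurable_EFinP; apply: measurable_funB => //.
  by apply: measurableT_comp => //; exact: measurableT_comp.
have : {ae P, forall w, (\sum_(n <oo) y n w < +oo)%E}.
  apply: ae_lty_of_integral.
  - exact: ge0_emeasurable_sum.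
  - by move=> w; exact: nneseries_ge0.
  rewrite integral_nneseries//; apply: le_lt_trans cu.
  apply: lee_nneseries => [n _ _|n _]; first exact: integral_ge0.
  rewrite (integral_1Bexp P (x n) (mx n) (x0 n)).
  rewrite (laplace_max_subordinator hS _ _ (c0 n) (u0 n)) -EFinB lee_fin.
  by rewrite lerBlDl -lerBlDr expR_ge1Dx.
apply: filterS => w; exact: nneseries_lty_of_1Bexp.
Qed.

Lemma ae_integral_powR_lty theta T : 0 < theta -> theta < alpha^-1 -> 0 < T ->
  {ae P, forall w, (integral_dS S (fun t => t `^ (- theta))%R T w < +oo)%E}.
Proof.
move=> th0 th1 T0.
pose u n := T * 2^-1 ^+ n.
have u_gt0 n : 0 < u n by rewrite mulr_gt0// exprn_gt0// invr_gt0.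
have uE n : u n = 2 * u n.+1 by rewrite /u exprS; field.
have du n : u n.+1 <= u n by rewrite [leRHS]uE ler_peMl ?ler1n// ltW.
have uT : u 0%N = T by rewrite /u mulr1.
pose c n := u n.+1 `^ (- theta).
have c0 n : 0 < c n by rewrite powR_gt0.
pose q := 1 - theta * alpha.
have q0 : 0 < q by rewrite subr_gt0 -ltr_pdivlMr// div1r.
(* Up to the factor 2 this is (u n.+1)^(1 - theta alpha), geometric with ratio below 1 because theta
   alpha < 1. *)
have cu n : c n `^ alpha * u n = 2 * T `^ q * 2 `^ (- q) * (2 `^ (- q)) ^+ n.
  rewrite uE /c -powRrM mulrCA -{2}[u n.+1]powRr1 ?(ltW (u_gt0 _))//.
  rewrite -powRD ?(lt0r_neq0 (u_gt0 _)) ?implybT//.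
  rewrite (_ : - theta * alpha + 1 = q); last by rewrite /q; ring.
  by rewrite (powR_halving _ _ _ (ltW T0)) exprS !mulrA.
have := ae_subordinator_series_lty c u c0 (fun n => ltW (u_gt0 n)).
have -> : (\sum_(n <oo) (c n `^ alpha * u n)%:E < +oo)%E.
  under eq_eseriesr do rewrite cu EFinM.
  rewrite nneseriesZl; last by move=> n _; rewrite lee_fin exprn_ge0// powR_ge0.
  by rewrite nneseries_geometric ?powR_ge0 ?powR2N_lt1// -EFinM ltry.
move=> /(_ isT); apply: filterS3 (ae_regular_path hS) (subordinator_ge0 hS).
move=> w [Fc Fi] S0 cS; rewrite /integral_dS -uT.
apply: le_lt_trans cS; apply: le_trans.
  apply: (path_integral_le _ _ Fc Fi (measurable_powR _) _ u _ du _ c).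
  - by move=> x; exact: powR_ge0.
  - by move=> n; exact: ltW.
  - by move=> t; exact: exists_halving_lt.
  - by move=> n; exact: ltW.
  - move=> n t ut _; have t0 := lt_trans (u_gt0 n.+1) ut.
    rewrite /c !powRN lef_pV2 ?posrE ?powR_gt0// ge0_ler_powR ?nnegrE//; exact: ltW.
apply: lee_nneseries => [n _ _|n _].
  by rewrite lee_fin mulr_ge0 ?(ltW (c0 n))// subr_ge0 Fi// ltW.
(* An increment is at most its upper endpoint value, as the path is nonnegative. *)
rewrite lee_fin ler_wpM2l ?(ltW (c0 n))// max_l ?S0 ?(ltW (u_gt0 _))//.
by rewrite gerBl S0// ltW.
Qed.

End path_finiteness.

(** * Almost sure divergence from the critical exponent on *)

Section path_divergence.
Context {R : realType} {d : measure_display} {Omega : measurableType d}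
  {P : probability Omega R}.
Context {alpha : R} {S : R -> {RV P >-> R}}.
Hypotheses (alpha_gt0 : 0 < alpha) (hS : stable_subordinator alpha S).

(* Markov's inequality for [exp (- c S_h)], whose expectation is at most
   [exp (- 1 / 2)]. *)
Lemma prob_small_subordinator (c h : R) : 0 < c -> 0 <= h ->
  2^-1 <= c `^ alpha * h ->
  (P (S h @^-1` `]-oo, ((4 * c)^-1)%R]%classic) <= (expR (- 4^-1))%:E)%E.
Proof.
move=> c0 h0 ch; set A := (X in P X).
have mA : measurable A by apply: measurable_funPTI; exact: measurable_itv.
rewrite -[A]setIT -integral_indic//.
have mE : measurable_fun setT (fun w => expR (- (c * Num.max (S h w) 0))).
  apply: measurableT_comp => //; apply: measurableT_comp => //.
  by apply: measurable_funM => //; exact: measurable_maxr.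
(* On the event, c S_h <= 1/4, so 1 <= exp (1/4) exp (- c S_h); the final exponent is 1/4 - 1/2 = -
   1/4. *)
apply: (@le_trans _ _ (\int[P]_w ((expR 4^-1)%:E *
    (expR (- (c * Num.max (S h w) 0)))%:E))%E).
  apply: ge0_le_integral => //.
  - by apply/measurable_EFinP.
  - by apply/measurable_EFinP; exact: measurable_funM.
  - move=> w _; rewrite -EFinM lee_fin -expRD indicE.
    have [/set_mem|_] := boolP (w \in A); last by rewrite expR_ge0.
    rewrite /A /= in_itv/= => Sw; rewrite -[leLHS]expR0 ler_expR subr_ge0.
    have c4 : c * (4 * c)^-1 = 4^-1 by field; rewrite gt_eqF.
    rewrite -c4 ler_wpM2l ?(ltW c0)// ge_max Sw invr_ge0 mulr_ge0// ltW//.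
rewrite ge0_integralZl//.
- rewrite (laplace_max_subordinator hS _ _ c0 h0) -EFinM lee_fin -expRD ler_expR.
  lra.
- exact/measurable_EFinP.
Qed.

(** Any m of these independent events hold together with probability at most exp (- m / 4), which
    tends to 0. *)
Lemma prob_small_increments theta N : alpha^-1 <= theta ->
  P (\bigcap_(n in [set n | (N <= n)%N])
       (increment S (2^-1 ^+ n.+1) (2^-1 ^+ n) @^-1`
          `]-oo, (4 * (2^-1 ^+ n) `^ (- theta))^-1]%classic)) = 0%E.
Proof.
move=> th1; pose u n : R := 2^-1 ^+ n.
have u_gt0 n : 0 < u n by rewrite exprn_gt0// invr_gt0.
have uE n : u n = 2 * u n.+1 by rewrite /u exprS; field.
pose c n := u n `^ (- theta).
have c0 n : 0 < c n by rewrite powR_gt0.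
pose B n := `]-oo, (4 * c n)^-1]%classic : set R.
have mB n : measurable (B n) by exact: measurable_itv.
pose A n := increment S (u n.+1) (u n) @^-1` B n.
have mA n : measurable (A n) by exact: measurable_funPTI.
have PA n : (P (A n) <= (expR (- 4^-1))%:E)%E.
  have h0 : 0 <= u n.+1 by exact: ltW.
  have := levy_stationary (subordinator_levy hS) h0 h0 (mB n).
  rewrite /distribution /pushforward (_ : u n.+1 + u n.+1 = u n); last first.
    by rewrite [RHS]uE; ring.
  move=> ->; apply: prob_small_subordinator => //.
  (* The increment has length u_n / 2, so the quantity to bound is u_n^(1 - theta alpha) / 2; it is
     at least 1/2 because theta alpha >= 1 and u_n <= 1. *)
  rewrite /c -powRrM mulNr powRN.
  have ta : 1 <= theta * alpha by rewrite -ler_pdivrMr// div1r.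
  have : u n `^ (theta * alpha) <= u n.
    rewrite -[leRHS]powRr1 ?(ltW (u_gt0 n))// ger_powR//.
    by rewrite u_gt0 exprn_ile1// invf_le1 ?ler1n.
  rewrite [leRHS]uE => hu; rewrite mulrC ler_pdivlMr ?powR_gt0//.
  by rewrite ler_pdivrMl.
set D := (X in P X).
have mD : measurable D by apply: bigcap_measurableType => n _; exact: mA.
have PD m : (P D <= (expR (- 4^-1) ^+ m)%:E)%E.
  (* Independence is stated for increasing times, so the dyadic times are listed backwards; the i-th
     increment then carries the index N + (m - i.+1). *)
  pose t i := u (N + (m - i))%N.
  have t_homo : {homo t : i j / (i <= j)%N >-> i <= j}.
    move=> i j ij; rewrite /t /u ler_wiXn2l ?invr_ge0 ?invf_le1 ?ler1n//.
    by rewrite leq_add2l leq_sub2l.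
  have indep := @levy_independent _ _ _ _ _ (subordinator_levy hS) m t
    (ltW (u_gt0 _)) t_homo.
  have tE (i : 'I_m) : t i = u (N + (m - i.+1)).+1.
    by rewrite /t -addnS subnSK.
  apply: (@le_trans _ _ (P (\bigcap_(i in [set: 'I_m])
      (increment S (t i) (t i.+1) @^-1` B (N + (m - i.+1))%N)))).
    apply: le_measure; rewrite ?inE//.
      by apply: fin_bigcap_measurable => // i _; exact: measurable_funPTI.
    move=> w Dw i _; rewrite tE; apply: (Dw (N + (m - i.+1))%N).
    by rewrite /= leq_addr.
  rewrite (indep (fun i => B (N + (m - i.+1))%N) (fun i => mB _)).
  have -> : ((expR (- 4^-1) ^+ m)%:E = \big[*%E/1%E]_(i < m) (expR (- 4^-1) : R)%:E)%E.
    by rewrite prodEFin prodr_const card_ord.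
  apply: (@proj2 (0 <= _)%E).
  apply: (big_ind2 (fun x y => (0 <= x)%E /\ (x <= y)%E)).
  - by [].
  - by move=> x1 y1 x2 y2 [? ?] [? ?]; split; [exact: mule_ge0|exact: lee_pmul].
  - by move=> i _; split => //; rewrite tE; exact: PA.
apply/eqP; rewrite eq_le measure_ge0 andbT.
have PDfin : P D \is a fin_num by exact: fin_num_measure.
rewrite -(fineK PDfin) lee_fin leNgt; apply/negP => PD0.
have e1 : 1 < expR 4^-1 :> R by rewrite expR_gt1 invr_gt0.
have [m] := exists_ltr_exprn _ (fine (P D))^-1 e1.
apply/negP; rewrite -leNgt -[leLHS]invrK lef_pV2 ?posrE ?invr_gt0 ?exprn_gt0 ?expR_gt0//.
have := PD m; rewrite -{1}(fineK PDfin) lee_fin => /le_trans; apply.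
by rewrite -exprVn -expRN.
Qed.

(** On each dyadic piece the integrand is at least its value at the right endpoint, and almost
    surely infinitely many of the resulting terms exceed 1/4. *)
Lemma ae_integral_powR_pinfty theta : alpha^-1 <= theta ->
  {ae P, forall w, forall T : R, 0 < T ->
    integral_dS S (fun t => t `^ (- theta)) T w = +oo%E}.
Proof.
move=> th1; have th0 : 0 < theta by rewrite (lt_le_trans _ th1)// invr_gt0.
pose u n : R := 2^-1 ^+ n.
have u_gt0 n : 0 < u n by rewrite exprn_gt0// invr_gt0.
have du n : u n.+1 <= u n.
  by rewrite /u exprS ler_piMl ?(ltW (u_gt0 n))// invf_le1 ?ler1n.
pose c n := u n `^ (- theta).
have c0 n : 0 < c n by rewrite powR_gt0.
have large : {ae P, forall w, forall N,
    exists2 n, (N <= n)%N & 4^-1 < c n * (S (u n) w - S (u n.+1) w)}.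
  apply: ae_foralln => N; have := prob_small_increments theta N th1.
  set D := (X in P X) => PD0; exists D; split => //.
    apply: bigcap_measurableType => n _.
    by apply: measurable_funPTI; exact: measurable_itv.
  move=> w /= hw n Nn; rewrite /= in_itv/= leNgt; apply/negP => Sw.
  apply: hw; exists n => //.
  have c4 : 4^-1 = c n * (4 * c n)^-1 by field; rewrite gt_eqF.
  by rewrite c4 ltr_pM2l.
apply: filterS2 (ae_regular_path hS) large => w [Fc Fi] large T T0.
(* Starting the partition at some u_N < T uses only a tail of one fixed sequence, so a single null
   set serves all T. *)
have [N NT] := exists_halving_lt 1 T T0; rewrite mul1r in NT.
apply/eqP; rewrite -leye_eq.
apply: (@le_trans _ _ (integral_dS S (fun t => t `^ (- theta)) (u (N + 0)%N) w)).
  have u0 n : 0 <= u (N + n)%N by exact: ltW.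
  apply: (@le_trans _ _
      (\sum_(n <oo) (c (N + n)%N * (S (u (N + n)%N) w - S (u (N + n.+1)%N) w))%:E)%E).
    rewrite (@nneseries_pinfty_often _ _ 4^-1)//.
    - by move=> n; rewrite mulr_ge0 ?(ltW (c0 _))// subr_ge0 addnS Fi// ltW.
    - move=> M; have [n Mn hn] := large (N + M)%N.
      exists (n - N)%N; first by rewrite leq_subRL// (leq_trans _ Mn)// leq_addr.
      by rewrite addnS subnKC// (leq_trans _ Mn)// leq_addr.
  apply: (path_integral_ge _ _ Fc Fi (measurable_powR _) _ (fun n => u (N + n)%N) u0 _ _
    (fun n => c (N + n)%N)).
  - by move=> x; exact: powR_ge0.
  - by move=> n; rewrite addnS.
  - move=> t t0; have [n hn] := exists_halving_lt 1 t t0; exists n.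
    rewrite mul1r in hn; apply: le_lt_trans hn.
    by rewrite /u ler_wiXn2l ?invr_ge0 ?invf_le1 ?ler1n// leq_addl.
  - by move=> n; exact: ltW.
  - move=> n t ut tu; have t0 : 0 < t by exact: le_lt_trans ut.
    rewrite /c !powRN lef_pV2 ?posrE ?powR_gt0// ge0_ler_powR ?nnegrE//; exact: ltW.
apply: le_path_integral; [exact: measurable_powR|by move=> x; exact: powR_ge0|].
by rewrite addn0 ltW.
Qed.

End path_divergence.

(** * Uniformity in T and assembly of the four claims *)

Theorem theorem1p1 (R : realType) (d : measure_display)
    (Omega : measurableType d) (P : probability Omega R)
    (alpha : R) (alpha_gt0 : 0 < alpha) (alpha_lt1 : alpha < 1)
    (S : R -> {RV P >-> R}) (hS : stable_subordinator alpha S) :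
  [/\ (forall theta : R, alpha^-1 <= theta ->
        {ae P, forall w, forall T : R, 0 < T ->
          integral_dS S (fun t => t `^ (- theta)) T w = +oo%E}),
      (forall theta : R, 0 < theta -> theta < alpha^-1 ->
        {ae P, forall w, forall T : R, 0 < T ->
          (integral_dS S (fun t => t `^ (- theta))%R T w < +oo)%E}),
      (forall theta : R, 0 < theta -> theta < alpha^-1 ->
       forall p : R, 0 < p -> p < alpha ->
       forall T : R, 0 < T ->
        (\int[P]_w (integral_dS S (fun t => t `^ (- theta))%R T w `^ p) <=
         ((2 `^ (p / alpha + p * theta) /
             (2 `^ (p / alpha) - 2 `^ (p * theta)))%R%:E *
            'E_P[fun w => (S 1 w `^ p)%R] + 1) *
         (T `^ ((alpha^-1 - theta) * p))%R%:E)%E) &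
      (forall lambda : R, 0 < lambda ->
       forall p : R, 0 < p -> p < alpha ->
       forall T : R, 0 < T ->
        (\int[P]_w (integral_dS S
                      (fun t => expR (- (lambda * (T - t))))%R T w `^ p) <=
         (expR (p * lambda) / (expR (p * lambda) - 1))%R%:E *
         'E_P[fun w => (S 1 w `^ p)%R])%E)].
Proof.
split.
- by move=> theta; exact: ae_integral_powR_pinfty.
- move=> theta th0 th1.
  (* Countably many integer horizons share one null set, and the integral is monotone in T. *)
  have : {ae P, forall w, forall m : nat,
      (integral_dS S (fun t => t `^ (- theta))%R m.+1%:R w < +oo)%E}.
    apply: ae_foralln => m.
    exact: (ae_integral_powR_lty alpha_gt0 hS theta _ th0 th1 (ltr0Sn R m)).
  apply: filterS => w fin T T0; apply: le_lt_trans (fin (Num.bound T)).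
  apply: le_path_integral; [exact: measurable_powR|by move=> x; exact: powR_ge0|].
  by rewrite ltW// (lt_le_trans (archi_boundP (ltW T0)))// ler_nat.
- move=> theta th0 th1 p p0 pa T T0; rewrite unlock.
  apply: le_trans.
    exact: (moment_integral_powR alpha_gt0 hS theta p T).
  set E := (\int[P]_w (S 1 w `^ p)%:E)%E.
  have E0 : (0 <= E)%E by apply: integral_ge0 => w _; rewrite lee_fin powR_ge0.
  rewrite EFinM muleAC; apply: lee_wpmul2r; first by rewrite lee_fin powR_ge0.
  by rewrite leeDl.
- move=> lambda l0 p p0 pa T T0; rewrite unlock.
  by apply: (moment_integral_expR hS) => //; rewrite ltW// (lt_trans pa).
Qed.
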